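(* Suppose that $\mathcal{C}\subseteq L^0_{c+}$ and $\mathcal{Q}\subseteq\mathfrak{P}_c(\Omega)$ are non-empty. Let $$\mathcal{C}^\diamond_{\mathcal{Q}}:=\{(Q,Z)\in\mathcal{Q}\times L^0_{c+}:\forall X\in\mathcal{C}\ \ E_Q[ZX]\le 1\},\qquad \mathcal{C}^{\diamond\diamond}_{\mathcal{Q}}:=\{X\in L^0_{c+}:\forall (Q,Z)\in\mathcal{C}^\diamond_{\mathcal{Q}}\ \ E_Q[ZX]\le 1\},$$ and $$\mathcal{C}^\circ_{\mathcal{Q}}:=\{(Q,Z)\in\mathcal{Q}\times L^\infty_{c+}:\forall X\in\mathcal{C}\ \ E_Q[ZX]\le 1\},\qquad \mathcal{C}^{\circ\circ}_{\mathcal{Q}}:=\{X\in L^0_{c+}:\forall (Q,Z)\in\mathcal{C}^\circ_{\mathcal{Q}}\ \ E_Q[ZX]\le 1\}.$$ Then $\mathcal{C}^{\diamond\diamond}_{\mathcal{Q}}=\mathcal{C}^{\circ\circ}_{\mathcal{Q}}$.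
   Context: $(\Omega,\mathcal{F})$ is an arbitrary measurable space, $\mathfrak{P}(\Omega)$ the set of probability measures on it, and $\mathcal{P}\subseteq\mathfrak{P}(\Omega)$ a fixed non-empty set. Put $c[A]:=\sup_{P\in\mathcal{P}}P[A]$, $A\in\mathcal{F}$. An event $A$ is $\mathcal{P}$-polar if $c[A]=0$; a property holds $\mathcal{P}$-q.s. if it holds outside a $\mathcal{P}$-polar event. $\mathfrak{P}_c(\Omega)$ is the set of $Q\in\mathfrak{P}(\Omega)$ with $Q[N]=0$ for every $\mathcal{P}$-polar $N$. $L^0_c$ is the space of real-valued random variables on $(\Omega,\mathcal{F})$ modulo $\mathcal{P}$-q.s. equality, ordered by $X\preccurlyeq Y$ iff $X\le Y$ $\mathcal{P}$-q.s.; $L^\infty_c:=\{X\in L^0_c:\exists m>0\ |X|\preccurlyeq m\}$; $L^0_{c+}$, $L^\infty_{c+}$ are the positive cones. For $Q\in\mathfrak{P}_c(\Omega)$, $E_Q[X]$ for $X\in L^0_c$ is evaluated on any representative (values in $[0,\infty]$ for $X\in L^0_{c+}$). *)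

(* Defs.v *)
From HB Require Import structures.
From mathcomp Require Import all_boot all_order all_algebra generic_quotient.
From mathcomp Require Import all_classical all_reals all_analysis.
From mathcomp Require Import measurable_realfun.

Set Implicit Arguments.
Unset Strict Implicit.
Unset Printing Implicit Defensive.

Import Order.TTheory GRing.Theory Num.Theory.
Import numFieldNormedType.Exports.

Local Open Scope classical_set_scope.
Local Open Scope ring_scope.
Local Open Scope quotient_scope.

Section quasi_sure.
Context (d : measure_display) (T : measurableType d) (R : realType).
Implicit Types (PP : set (probability T R)) (f g : {mfun T >-> R}).

Definition capacity PP (A : set T) : \bar R :=
  ereal_sup [set P A | P in PP].

Definition polar PP (N : set T) : Prop :=
  measurable N /\ capacity PP N = 0%E.

(* The exceptional event contains the set where the property fails; that set
   need not itself be measurable. *)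
Definition quasi_surely PP (p : T -> Prop) : Prop :=
  exists N, polar PP N /\ forall w, ~ N w -> p w.

Definition prob_c PP : set (probability T R) :=
  [set Q | forall N, polar PP N -> Q N = 0%E].

Lemma polarP PP (N : set T) : PP !=set0 ->
  polar PP N <-> measurable N /\ forall P, PP P -> P N = 0%E.
Proof.
move=> [P0 PP0]; split=> -[mN h]; split=> //.
  move=> P PPP; apply/eqP; rewrite eq_le measure_ge0 andbT -h.
  by apply: ereal_sup_ubound; exists P.
apply/eqP; rewrite eq_le; apply/andP; split.
  by apply: ge_ereal_sup => _ [P PPP <-]; rewrite h.
by rewrite -(h _ PP0); apply: ereal_sup_ubound; exists P0.
Qed.

Lemma polar_set0 PP : PP !=set0 -> polar PP set0.
Proof. by move=> PP0; apply/(polarP _ PP0); split=> // P _; exact: measure0. Qed.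

Lemma polarU PP (M N : set T) : PP !=set0 ->
  polar PP M -> polar PP N -> polar PP (M `|` N).
Proof.
move=> PP0 /(polarP _ PP0)[mM M0] /(polarP _ PP0)[mN N0].
apply/(polarP _ PP0); split; first exact: measurableU.
by move=> P PPP; apply: null_set_setU => //; [exact: M0|exact: N0].
Qed.

Lemma qs_all PP (p : T -> Prop) : PP !=set0 ->
  (forall w, p w) -> quasi_surely PP p.
Proof. by move=> PP0 pT; exists set0; split=> //; exact: polar_set0. Qed.

Lemma qs_and PP (p q r : T -> Prop) : PP !=set0 ->
  (forall w, p w -> q w -> r w) ->
  quasi_surely PP p -> quasi_surely PP q -> quasi_surely PP r.
Proof.
move=> PP0 pqr [M [pM hM]] [N [pN hN]]; exists (M `|` N).
split; first exact: polarU.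
by move=> w /not_orP[/hM pw /hN qw]; exact: pqr.
Qed.

Definition qs_eq PP f g : bool := `[< quasi_surely PP (fun w => f w = g w) >].

End quasi_sure.

(* The set of priors has to be non-empty for q.s. equality to be reflexive:
   otherwise the capacity is -oo and there is no polar event. *)
Section L0.
Context (d : measure_display) (T : measurableType d) (R : realType).
Context (PP : set (probability T R)) (PP0 : PP !=set0).

Lemma qs_eq_refl : reflexive (@qs_eq d T R PP).
Proof. by move=> f; apply/asboolP; exact: qs_all. Qed.

Lemma qs_eq_sym : symmetric (@qs_eq d T R PP).
Proof.
by move=> f g; apply/asboolP/asboolP => -[N [pN h]]; exists N; split=> // w /h.
Qed.

Lemma qs_eq_trans : transitive (@qs_eq d T R PP).
Proof.
move=> g f h /asboolP fg /asboolP gh; apply/asboolP.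
by apply: qs_and fg gh => // w -> ->.
Qed.

Definition qs_eq_equiv := EquivRel _ qs_eq_refl qs_eq_sym qs_eq_trans.

Definition L0 : Type := {eq_quot qs_eq_equiv}.
HB.instance Definition _ := Choice.on L0.
HB.instance Definition _ := EqQuotient.on L0.

Implicit Types (X Y Z : L0) (f g : {mfun T >-> R}).

Definition L0_le X Y : Prop :=
  quasi_surely PP (fun w => (repr X : {mfun T >-> R}) w <=
                            (repr Y : {mfun T >-> R}) w).

Definition L0_cst (a : R) : L0 := \pi_L0 (cst a : {mfun T >-> R}).

Definition L0_norm X : L0 :=
  \pi_L0 (@Num.norm R R \o (repr X : {mfun T >-> R}) : {mfun T >-> R}).

Definition L0_mul X Y : L0 := \pi_L0 (repr X * repr Y : {mfun T >-> R}).

Definition L0_expectation (Q : probability T R) X : \bar R :=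
  'E_Q[(repr X : {mfun T >-> R})]%E.

Definition L0_pos : set L0 := [set X | L0_le (L0_cst 0) X].

Definition Linfty : set L0 :=
  [set X | exists m : R, 0 < m /\ L0_le (L0_norm X) (L0_cst m)].

Definition Linfty_pos : set L0 := Linfty `&` L0_pos.

(* The operations above do not depend on the choice of representatives; for
   the expectation this needs Q to vanish on polar events. *)

Lemma L0_eqP f g :
  \pi_L0 f = \pi_L0 g <-> quasi_surely PP (fun w => f w = g w).
Proof.
split=> [/eqP|fg]; first by rewrite eqmodE => /asboolP.
by apply/eqP; rewrite eqmodE; apply/asboolP.
Qed.

Lemma repr_qs f :
  quasi_surely PP (fun w => (repr (\pi_L0 f) : {mfun T >-> R}) w = f w).
Proof. by apply/L0_eqP; rewrite reprK. Qed.

Lemma L0_leE f g :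
  L0_le (\pi_L0 f) (\pi_L0 g) <-> quasi_surely PP (fun w => f w <= g w).
Proof.
have := qs_and PP0 (fun w a b => conj a b) (repr_qs f) (repr_qs g).
by move=> h; split; apply: qs_and h => // w [-> ->].
Qed.

Lemma L0_normE f :
  L0_norm (\pi_L0 f) = \pi_L0 (@Num.norm R R \o f : {mfun T >-> R}).
Proof.
by apply/L0_eqP; have [N [pN h]] := repr_qs f; exists N; split=> // w /h wE; rewrite /= wE.
Qed.

Lemma L0_mulE f g : L0_mul (\pi_L0 f) (\pi_L0 g) = \pi_L0 (f * g).
Proof.
apply/L0_eqP; apply: qs_and (repr_qs f) (repr_qs g) => // w fE gE.
by rewrite !mfunM /= fE gE.
Qed.

Lemma L0_expectationE (Q : probability T R) f : prob_c PP Q ->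
  L0_expectation Q (\pi_L0 f) = 'E_Q[f]%E.
Proof.
move=> QP; rewrite /L0_expectation unlock.
apply: ae_eq_integral => //; [exact/measurable_EFinP|exact/measurable_EFinP|].
have [N [pN h]] := repr_qs f; exists N; split; [exact: pN.1|exact: QP|].
move=> w /= hw; apply: contrapT => /h wE; apply: hw => _.
by rewrite wE.
Qed.

End L0.

Arguments L0_pos {d T R PP} PP0 _.
Arguments Linfty {d T R PP} PP0 _.
Arguments Linfty_pos {d T R PP} PP0 _.

Section duality.
Context (d : measure_display) (T : measurableType d) (R : realType).
Context (PP : set (probability T R)) (PP0 : PP !=set0).
Context (QQ : set (probability T R)) (C : set (L0 PP0)).

Definition diamond : set (probability T R * L0 PP0) :=
  [set QZ | [/\ QQ QZ.1, L0_pos PP0 QZ.2 &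
    forall X, C X -> (L0_expectation QZ.1 (L0_mul QZ.2 X) <= 1)%E]].

Definition bidiamond : set (L0 PP0) :=
  [set X | L0_pos PP0 X /\
    forall QZ, diamond QZ -> (L0_expectation QZ.1 (L0_mul QZ.2 X) <= 1)%E].

Definition circ : set (probability T R * L0 PP0) :=
  [set QZ | [/\ QQ QZ.1, Linfty_pos PP0 QZ.2 &
    forall X, C X -> (L0_expectation QZ.1 (L0_mul QZ.2 X) <= 1)%E]].

Definition bicirc : set (L0 PP0) :=
  [set X | L0_pos PP0 X /\
    forall QZ, circ QZ -> (L0_expectation QZ.1 (L0_mul QZ.2 X) <= 1)%E].

End duality.

(* Main.v *)
(** Bounded densities form a smaller polar, so the diamond bipolar is contained
    in the circle bipolar. Conversely, if [(Q, Z)] lies in the diamond polar, its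
    truncations [(Q, min Z n)] lie in the circle polar; for [X] in the circle
    bipolar this gives [E_Q[min Z n * X] <= 1] for all [n], and monotone
    convergence yields [E_Q[Z * X] <= 1]. *)

Require Import Defs.
From mathcomp Require Import all_boot all_order all_algebra.
From mathcomp Require Import all_classical all_reals all_analysis.
From mathcomp Require Import measurable_realfun.

Import Order.TTheory GRing.Theory Num.Theory.

Local Open Scope classical_set_scope.

Section truncation.
Local Open Scope ring_scope.
Context {d : measure_display} {T : measurableType d} {R : realType}.
Implicit Types (f g : {mfun T >-> R}) (P : probability T R).

Definition trunc_mfun f (n : nat) : {mfun T >-> R} :=
  min_mfun f (cst n%:R : {mfun T >-> R}).

Lemma trunc_mfunE f n w : trunc_mfun f n w = Num.min (f w) n%:R.
Proof. by []. Qed.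

Lemma trunc_mfun_ge0 {f} n w : 0 <= f w -> 0 <= trunc_mfun f n w.
Proof. by move=> f0; rewrite trunc_mfunE le_min f0 ler0n. Qed.

Lemma ge0_le_expectation P f g :
  (forall w, 0 <= f w) -> (forall w, f w <= g w) -> ('E_P[f] <= 'E_P[g])%E.
Proof.
move=> f0 fg; rewrite unlock; apply: ge0_le_integral => //=.
- by move=> w _; rewrite lee_fin.
- exact/measurable_EFinP.
- exact/measurable_EFinP.
- by move=> w _; rewrite lee_fin.
Qed.

Lemma expectation_trunc_le P f g (c : \bar R) :
  (forall w, 0 <= f w) -> (forall w, 0 <= g w) ->
  (forall n, ('E_P[(trunc_mfun f n * g : {mfun T >-> R})] <= c)%E) ->
  ('E_P[(f * g : {mfun T >-> R})] <= c)%E.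
Proof.
move=> f0 g0 hc.
pose h n w := ((trunc_mfun f n * g : {mfun T >-> R}) w)%:E.
have mh n : measurable_fun setT (h n) by exact/measurable_EFinP.
have h0 n w : setT w -> (0 <= h n w)%E.
  by move=> _; rewrite lee_fin;
  exact: mulr_ge0 (trunc_mfun_ge0 n w (f0 w)) (g0 w).
have ndh w : setT w -> nondecreasing_seq (h^~ w).
  move=> _ m n mn; rewrite lee_fin; apply: ler_wpM2r (g0 w) _ _ _.
  by rewrite /= le_min ge_min lexx /= ge_min ler_nat mn orbT.
have limh w : limn (h^~ w) = ((f * g : {mfun T >-> R}) w)%:E.
  apply: cvg_lim => //; apply: cvg_near_cst.
  (* At a fixed [w] the sequence is stationary: once [n] exceeds the integer part of [f w], the
     truncation no longer acts. *)
  exists (Num.truncn (f w)).+1 => // n /= fn; congr ((_ * _)%:E).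
  rewrite /= min_l //; apply: ltW; apply: (lt_le_trans (truncnS_gt _)).
  by rewrite ler_nat.
have := @cvg_monotone_convergence _ _ _ P _ measurableT _ mh h0 ndh.
rewrite (eq_integral (fun w => ((f * g : {mfun T >-> R}) w)%:E)) => [cvgh|w _].
  rewrite unlock; apply: (cvge_to_le cvgh); apply: nearW => n.
  by have := hc n; rewrite unlock.
exact: limh.
Qed.

End truncation.

Section L0_representatives.
Local Open Scope ring_scope.
Local Open Scope quotient_scope.
Context {d : measure_display} {T : measurableType d} {R : realType}.
Context {PP : set (probability T R)} (PP0 : PP !=set0).

(** The canonical representative is nonnegative only outside a polar event; its positive part
    differs from it only there, so it lies in the same class. *)
Lemma L0_pos_repr (X : L0 PP0) : L0_pos PP0 X ->
  exists2 f : {mfun T >-> R}, (forall w, 0 <= f w) & X = \pi_(L0 PP0) f.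
Proof.
move=> X0; exists (max_mfun (cst 0 : {mfun T >-> R}) (repr X)).
  by move=> w; rewrite /= le_max lexx.
rewrite -[LHS]reprK; apply/L0_eqP.
move: X0; rewrite /L0_pos /= -{1}[X]reprK => /L0_leE[N [pN hN]].
by exists N; split=> // w /hN /= h; rewrite max_r.
Qed.

Lemma L0_pos_pi {f : {mfun T >-> R}} :
  (forall w, 0 <= f w) -> L0_pos PP0 (\pi_(L0 PP0) f).
Proof. by move=> f0; apply/L0_leE; exact: qs_all. Qed.

Lemma Linfty_pi (f : {mfun T >-> R}) (m : R) : 0 < m ->
  (forall w, `|f w| <= m) -> Linfty PP0 (\pi_(L0 PP0) f).
Proof.
move=> m0 fm; exists m; split=> //.
by rewrite L0_normE; apply/L0_leE; exact: qs_all.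
Qed.

Lemma Linfty_pos_trunc (f : {mfun T >-> R}) n : (forall w, 0 <= f w) ->
  Linfty_pos PP0 (\pi_(L0 PP0) (trunc_mfun f n)).
Proof.
move=> f0; split; last by apply: L0_pos_pi => w; exact: trunc_mfun_ge0.
(* The bound is [n.+1] rather than [n] because [Linfty] asks for a strictly positive constant and
   [n] may be 0. *)
apply: (@Linfty_pi _ n.+1%:R) => // w.
rewrite ger0_norm ?trunc_mfun_ge0 // trunc_mfunE ge_min.
by rewrite ler_nat leqnSn orbT.
Qed.

End L0_representatives.

Lemma circ_sub_diamond (d : measure_display) (T : measurableType d)
    (R : realType) (PP : set (probability T R)) (PP0 : PP !=set0)
    (C : set (L0 PP0)) (QQ : set (probability T R)) :
  circ QQ C `<=` diamond QQ C.
Proof. by move=> QZ [QQZ [_ Z0] hZ]; split. Qed.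

Theorem theorem6p4 (d : measure_display) (T : measurableType d) (R : realType)
    (PP : set (probability T R)) (PP0 : PP !=set0)
    (C : set (L0 PP0)) (QQ : set (probability T R)) :
  C `<=` L0_pos PP0 -> C !=set0 ->
  QQ `<=` prob_c PP -> QQ !=set0 ->
  bidiamond QQ C = bicirc QQ C.
Proof.
move=> Cpos _ QQc _; apply/seteqP; split=> X [X0 hX]; split=> //.
  by move=> QZ /circ_sub_diamond; exact: hX.
move=> [Q Z] [/= QQQ Z0 hZ]; have Qc := QQc _ QQQ.
have [g g0 Xg] := L0_pos_repr PP0 X X0.
have [f f0 Zf] := L0_pos_repr PP0 Z Z0.
(* [Q] vanishes on polar events, so the expectation may be computed on the nonnegative
   representatives. *)
rewrite Xg Zf L0_mulE L0_expectationE //.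
apply: expectation_trunc_le => // n.
(* Back to classes, where the hypothesis on [X] applies to the truncated density. *)
rewrite -(L0_expectationE PP0) // -L0_mulE -Xg.
apply: (hX (Q, _)); split=> //=; first exact: Linfty_pos_trunc.
move=> Y CY; have [k k0 Yk] := L0_pos_repr PP0 Y (Cpos _ CY).
(* Truncating only lowers the density, and [k] is nonnegative, so the bound for [Z] is inherited. *)
apply: le_trans (hZ _ CY).
rewrite Yk Zf !L0_mulE !L0_expectationE //.
apply: ge0_le_expectation => w.
  exact: mulr_ge0 (trunc_mfun_ge0 n w (f0 w)) (k0 w).
by apply: ler_wpM2r (k0 w) _ _ _; rewrite /= ge_min lexx.
Qed.
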